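(* Let $f:\mathbb{R}^n\to\mathbb{R}$ be three times continuously differentiable, let $x^*$ be a minimizer of $f$, and let $\rho,\Lambda_1,\Lambda_2,L>0$ be constants as in the context. Let $\mathsf{K}_1$ be either the long KGD step-size $\mathcal{K}_1$ or the short KGD step-size $\mathcal{K}_1^{\rm s}$. Then there exists a positive number $r<\rho$ such that for any $0<\delta<r$ and any $x_0,x_1\in B_\delta(x^* )$ (where $x_1=x_0-\alpha_0G(x_0)$ with $\alpha_0>0$), the sequence $\{x_k\}$ generated by $$x_{k+1}=x_k-\alpha_kG(x_k),\qquad \alpha_{k+1}=\mathsf{K}_1(x_{k+1};x_k,\alpha_k)$$ converges to $x^*$ with at least an R-linear rate.
   Context: $G=\nabla f$, $H(x)=\nabla^2f(x)$, and $B_\rho(x^* )$ is the Euclidean ball of radius $\rho$ centred at $x^*$. Standing assumptions: (1) the sublevel set $\Omega=\{x: f(x)\le f(\bar x)\}$ of a given point $\bar x$ is compact, with $B_\rho(x^* )\subset\Omega$, and $v^{\mathrm T}H(x)v\le\Lambda_1\|v\|_2^2$ and $\|H(x)-H(y)\|_2\le L\|x-y\|_2$ for all $v\in\mathbb{R}^n$, $x,y\in\Omega$; (2) $v^{\mathrm T}H(x)v\ge\Lambda_2\|v\|_2^2$ for all $v\in\mathbb{R}^n$ and $x\in B_\rho(x^* )$. Step-sizes: for $\alpha>0$ and $x_{\rm new}=x-\alpha G(x)$, $$\mathcal{K}_1(x_{\rm new};x,\alpha)=\frac{\alpha}{2+\frac{2(f(x_{\rm new})-f(x))}{\alpha\|G(x)\|_2^2}},\qquad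 \mathcal{K}_1^{\rm s}(x_{\rm new};x,\alpha)=\frac{2(\alpha\|G(x)\|_2^2+f(x_{\rm new})-f(x))}{\|G(x_{\rm new})-G(x)\|_2^2}.$$ If $G(x_k)=0$ for some $k$, the iteration stops and the sequence is regarded as constant from then on. R-linear convergence: there exist $C>0$ and $\theta\in(0,1)$ with $\|x_k-x^*\|_2\le C\theta^k$ for all $k$. *)

(* Defs.v *)
From HB Require Import structures.
From mathcomp Require Import all_boot all_order all_algebra.
From mathcomp Require Import all_classical all_reals all_analysis.
Import Order.TTheory GRing.Theory Num.Theory.
Import numFieldNormedType.Exports.

Set Implicit Arguments.
Unset Strict Implicit.
Unset Printing Implicit Defensive.

Local Open Scope classical_set_scope.
Local Open Scope ring_scope.

(* Points of R^n are row vectors.  The norm `|v| that the library puts on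
   'rV[R]_n is the sup norm; it induces the usual topology, but the metric
   notions below need the Euclidean norm. *)
Definition norm2 (R : realType) (n : nat) (v : 'rV[R]_n) : R :=
  Num.sqrt (\sum_(i < n) v 0 i ^+ 2).

Definition eball (R : realType) (n : nat) (c : 'rV[R]_n) (d : R) :
    set 'rV[R]_n :=
  [set y | norm2 (y - c) < d].

(* On row vectors, v |-> A v reads v |-> v *m A^T. *)
Definition opnorm2 (R : realType) (n : nat) (A : 'M[R]_n) : R :=
  sup [set norm2 (v *m A^T) | v in [set v : 'rV[R]_n | norm2 v <= 1]].

Definition partial (R : realType) (n : nat) (i : 'I_n) (f : 'rV[R]_n -> R) :
    'rV[R]_n -> R :=
  fun x => 'D_(delta_mx 0 i) f x.

Fixpoint Ck (R : realType) (n k : nat) (f : 'rV[R]_n -> R) {struct k} : Prop :=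
  continuous f /\
  (if k is k'.+1 then
     forall i : 'I_n,
       (forall x, derivable f x (delta_mx 0 i)) /\ Ck k' (partial i f)
   else True).

Definition grad (R : realType) (n : nat) (f : 'rV[R]_n -> R)
    (x : 'rV[R]_n) : 'rV[R]_n :=
  \row_(i < n) partial i f x.

Definition hess (R : realType) (n : nat) (f : 'rV[R]_n -> R)
    (x : 'rV[R]_n) : 'M[R]_n :=
  \matrix_(i < n, j < n) partial j (partial i f) x.

(* v^T A v *)
Definition qform (R : realType) (n : nat) (A : 'M[R]_n) (v : 'rV[R]_n) : R :=
  (v *m A *m v^T) 0 0.

Definition sublevel (R : realType) (n : nat) (f : 'rV[R]_n -> R)
    (xbar : 'rV[R]_n) : set 'rV[R]_n :=
  [set x | f x <= f xbar].

Definition kgd_long (R : realType) (n : nat) (f : 'rV[R]_n -> R)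
    (xnew x : 'rV[R]_n) (a : R) : R :=
  a / (2 + 2 * (f xnew - f x) / (a * norm2 (grad f x) ^+ 2)).

Definition kgd_short (R : realType) (n : nat) (f : 'rV[R]_n -> R)
    (xnew x : 'rV[R]_n) (a : R) : R :=
  2 * (a * norm2 (grad f x) ^+ 2 + f xnew - f x)
    / norm2 (grad f xnew - grad f x) ^+ 2.

(* The step-size rule is imposed only while grad f (x k) != 0.  Once the
   gradient vanishes, the first equation keeps x constant whatever a is. *)
Definition kgd_iterates (R : realType) (n : nat) (f : 'rV[R]_n -> R)
    (K : 'rV[R]_n -> 'rV[R]_n -> R -> R)
    (x : nat -> 'rV[R]_n) (a : nat -> R) : Prop :=
  0 < a 0%N /\
  forall k : nat,
    x k.+1 = x k - a k *: grad f (x k) /\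
    (grad f (x k) != 0 -> a k.+1 = K (x k.+1) (x k) (a k)).

Definition R_linear (R : realType) (n : nat) (x : nat -> 'rV[R]_n)
    (xs : 'rV[R]_n) : Prop :=
  exists C theta : R,
    [/\ 0 < C, 0 < theta < 1 &
        forall k : nat, norm2 (x k - xs) <= C * theta ^+ k].

(* Main.v *)
Require Import Defs.
From HB Require Import structures.
From mathcomp Require Import all_boot all_order all_algebra.
From mathcomp Require Import all_classical all_reals all_analysis.
From mathcomp Require Import spectral complex.
From mathcomp Require Import ring lra.
Import Order.TTheory GRing.Theory Num.Theory.
Import numFieldNormedType.Exports.
Local Open Scope classical_set_scope.
Local Open Scope ring_scope.

Set Implicit Arguments.
Unset Strict Implicit.
Unset Printing Implicit Defensive.

(** Near the minimizer both step-sizes are, up to a relative error of the order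
   of the radius of the ball, inverse Rayleigh quotients of [H = hess f xs]:
   the long one is [g.g / g.Hg] and the short one [g.Hg / Hg.Hg], with [g] the
   previous gradient.  So in the eigendirection of [lam i] the error [x k - xs]
   is multiplied by [1 - b * lam i] up to a small multiple of its norm.  Steps
   stay in a fixed interval [(4U)^-1, 3/l], and as soon as the components
   belonging to smaller eigenvalues are negligible one has
   [b * lam i <= 3 / 2] at the next step, hence contraction by a fixed factor
   [cc < 1].  When they are not negligible, component [i] is itself controlled
   by those smaller components.  By induction on the eigenvalues every
   component is bounded by a constant times [theta ^ k], for any [theta] in
   (cc, 1), and this keeps the iterates in the ball where the perturbation
   estimates hold. *)

(** * Decay of perturbed gradient recursions *)

(* The component of index [i] is delayed by one step: the quotient formed at
   step [k] decides how it is damped between steps [k + 1] and [k + 2].  [D]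
   dominates both the initial values and the perturbation. *)
Lemma rank_majorant (R : realFieldType) (n : nat) (lam : 'I_n -> R)
    (B c theta kappa : R) :
  0 <= B -> 0 <= c -> c < theta -> theta < 1 -> 0 < kappa ->
  forall m : nat, exists2 C : R, 0 <= C &
  forall (u : nat -> 'I_n -> R) (D : R) (K : nat), 0 <= D ->
    (forall k i, 0 <= u k i) ->
    (forall i, u 0%N i <= D) -> (forall i, u 1%N i <= D) ->
    (forall k, (k.+1 < K)%N -> forall i,
       u k.+2 i <= B * u k.+1 i + D * theta ^+ k.+1 /\
       (\sum_(j | lam j < lam i) u k j <= kappa * \sum_j u k j ->
        u k.+2 i <= c * u k.+1 i + D * theta ^+ k.+1)) ->
    forall i, (#|[pred j | (lam j < lam i)%R]| < m)%N ->
    forall k, (k <= K)%N -> u k i <= C * D * theta ^+ k.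
Proof.
(* Induction on the bound [m] for the number of eigenvalues below [lam i]; the constant [C] depends
   on none of [u], [D], [K]. *)
move=> B0 c0 cth th1 kap0; elim=> [|m [C0 C00 IHm]]; first by exists 0.
have th0 : 0 < theta by apply: le_lt_trans cth.
have thc : 0 < theta - c by rewrite subr_gt0.
pose X := kappa^-1 * (n%:R * C0).
have X0 : 0 <= X by rewrite mulr_ge0 ?invr_ge0 ?mulr_ge0 // ltW.
pose Y := B * (B * X + 1) + B + 1.
have Y0 : 1 <= Y by rewrite /Y lerDr addr_ge0 // mulr_ge0 // addr_ge0 // mulr_ge0.
(* The first summand yields [c * C + 1 <= C * theta], which closes a damped step; the second yields
   [Y <= C * theta ^+ 2], which pays for two undamped steps starting from the bound [X]. *)
pose C := (theta - c)^-1 + theta ^- 2 * Y.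
have th2Y : 0 <= theta ^- 2 * Y.
  by rewrite mulr_ge0 ?invr_ge0 ?exprn_ge0 ?(ltW th0) // (le_trans ler01).
have C_thc : 1 <= C * (theta - c).
  by rewrite mulrDl mulVf ?gt_eqF // lerDl mulr_ge0 // ltW.
have C_th2 : Y <= C * theta ^+ 2.
  rewrite mulrDl mulrAC mulVf ?mul1r; last by rewrite expf_neq0 // gt_eqF.
  by rewrite lerDr mulr_ge0 ?invr_ge0 ?exprn_ge0 ?(ltW thc) ?(ltW th0).
have C_ge0 : 0 <= C by rewrite addr_ge0 // invr_ge0 ltW.
have C_th : 1 <= C * theta by nra.
have C1 : 1 <= C by nra.
exists C => // u D K D0 u0 uD0 uD1 hu i rki.
(* If the lower components are not negligible, their sum exceeds [kappa * u k i], while the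
   induction hypothesis on [m] bounds each of them. *)
have uX k : (k <= K)%N ->
    ~ (\sum_(j | lam j < lam i) u k j <= kappa * \sum_j u k j) ->
    u k i <= X * D * theta ^+ k.
  move=> kK /negP; rewrite -ltNge => hlt.
  have low : \sum_(j | lam j < lam i) u k j <= n%:R * (C0 * D * theta ^+ k).
    apply: (@le_trans _ _ (\sum_(j | lam j < lam i) C0 * D * theta ^+ k)).
      apply: ler_sum => j ltji; apply: (IHm u D K) => //.
      rewrite -ltnS; apply: leq_trans rki; rewrite ltnS; apply: proper_card.
      apply/properP; split; last by exists j; rewrite !inE ?ltxx.
      by apply/fintype.subsetP => z; rewrite !inE => /lt_trans; apply.
    rewrite sumr_const -[leLHS]mulr_natl ler_wpM2r ?mulr_ge0 ?exprn_ge0 ?(ltW th0) //.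
    by rewrite ler_nat (leq_trans (max_card _)) // card_ord.
  have ui : u k i <= \sum_j u k j.
    by rewrite (bigD1 i) //= lerDl sumr_ge0.
  have : kappa * u k i <= n%:R * (C0 * D * theta ^+ k).
    apply: le_trans low; apply: le_trans (ltW hlt).
    by rewrite ler_wpM2l // ltW.
  by rewrite mulrC -ler_pdivlMr // => /le_trans; apply; rewrite /X; lra.
elim=> [|k IHk] kK.
  by rewrite expr0 mulr1 (le_trans (uD0 i)) // ler_peMl.
case: k kK IHk => [|k] kK IHk.
  by rewrite expr1 mulrAC (le_trans (uD1 i)) // ler_peMl.
have {IHk} IHk := IHk (ltnW kK).
have thk : 0 <= theta ^+ k by rewrite exprn_ge0 // ltW.
have Dthk : 0 <= D * theta ^+ k by rewrite mulr_ge0.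
have [huB huc] := hu k kK i.
have [/huc le_u|hlt] := boolP (\sum_(j | lam j < lam i) u k j <= kappa * \sum_j u k j).
  apply: (le_trans le_u); rewrite !exprS in IHk *.
  have h1 : c * u k.+1 i <= c * (C * D * (theta * theta ^+ k)) by rewrite ler_wpM2l.
  have h2 : 0 <= (C * (theta - c) - 1) * theta * (D * theta ^+ k).
    by rewrite mulr_ge0 ?mulr_ge0 ?subr_ge0 // ltW.
  nra.
(* Without damping, the bound restarts from [uX] at [k] and crosses two steps of factor [B]. For
   [k = 0] the value [u 1 i] is bounded by [D] directly, since the recursion only begins at index
   2. *)
have u1 : u k.+1 i <= (B * X + 1) * (D * theta ^+ k).
  case: k {huB huc} kK IHk thk Dthk hlt => [|k] kK IHk thk Dthk /negP hlt.
    by rewrite expr0 mulr1 (le_trans (uD1 i)) // ler_peMl // lerDr mulr_ge0.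
  have [+ _] := hu k (ltnW kK) i; move/le_trans; apply.
  have := uX k.+1 (ltnW (ltnW kK)) hlt => /(ler_wpM2l B0); lra.
apply: (le_trans huB); rewrite !exprS.
have h1 : B * u k.+1 i <= B * ((B * X + 1) * (D * theta ^+ k)) by rewrite ler_wpM2l.
have h2 : 0 <= (C * theta ^+ 2 - Y) * (D * theta ^+ k) by rewrite mulr_ge0 // subr_ge0.
have h3 : 0 <= (1 - theta) * (D * theta ^+ k) by rewrite mulr_ge0 // subr_ge0 ltW.
have h4 : 0 <= B * (D * theta ^+ k) by rewrite mulr_ge0.
move: h1 h2 h3 h4; rewrite /Y; lra.
Qed.

(* The perturbation, being a small multiple of the sum to be bounded, is
   absorbed by taking its factor to be the inverse of the constant obtained in
   the conclusion. *)
Lemma spectral_decay (R : realFieldType) (n : nat) (lam : 'I_n -> R)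
    (B c theta kappa : R) :
  0 <= B -> 0 <= c -> c < theta -> theta < 1 -> 0 < kappa ->
  exists2 M : R, 1 <= M &
  forall (u : nat -> 'I_n -> R) (K : nat),
    (forall k i, 0 <= u k i) ->
    (forall k, (k.+1 < K)%N -> forall i,
       u k.+2 i <= B * u k.+1 i + M^-1 * \sum_j u k.+1 j /\
       (\sum_(j | lam j < lam i) u k j <= kappa * \sum_j u k j ->
        u k.+2 i <= c * u k.+1 i + M^-1 * \sum_j u k.+1 j)) ->
    forall k, (k <= K)%N ->
      \sum_i u k i <= M * (\sum_i u 0%N i + \sum_i u 1%N i) * theta ^+ k.
Proof.
move=> B0 c0 cth th1 kap0.
have th0 : 0 < theta by apply: le_lt_trans cth.
have [C C0 hC] := @rank_majorant R n lam B c theta kappa B0 c0 cth th1 kap0 n.+1.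
pose M := n%:R * C + 1.
have M1 : 1 <= M by rewrite lerDr mulr_ge0.
have M0 : 0 < M by apply: lt_le_trans M1.
exists M => // u K u0; pose S := \sum_i u 0%N i + \sum_i u 1%N i.
have S0 : 0 <= S by rewrite addr_ge0 // sumr_ge0.
have term k i : u k i <= \sum_j u k j by rewrite (bigD1 i) //= lerDl sumr_ge0.
have uS0 i : u 0%N i <= S by rewrite (le_trans (term _ _)) // lerDl sumr_ge0.
have uS1 i : u 1%N i <= S by rewrite (le_trans (term _ _)) // lerDr sumr_ge0.
elim: K => [|K IHK] hu.
  move=> [|//] _; rewrite expr0 mulr1 -/S.
  apply: (@le_trans _ _ S); first by rewrite lerDl sumr_ge0.
  by rewrite ler_peMl.
have {}IHK := IHK (fun k kK => hu k (ltnW kK)).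
(* The bound already known up to [K] turns the perturbation into [S * theta ^+ k.+1], the form
   required with [D = S]. *)
have etaS k : (k.+1 < K.+1)%N -> M^-1 * \sum_j u k.+1 j <= S * theta ^+ k.+1.
  by move=> kK; rewrite ler_pdivrMl // mulrA; exact: IHK.
have hr := hC u S K.+1 S0 u0 uS0 uS1.
move=> k kK; apply: (@le_trans _ _ (\sum_(i < n) C * S * theta ^+ k)).
  apply: ler_sum => i _; apply: hr => //.
    move=> j jK l; have [h1 h2] := hu j jK l; have h3 := etaS j jK; split.
      by apply: (le_trans h1); rewrite lerD2l.
    by move/h2 => {}h2; apply: (le_trans h2); rewrite lerD2l.
  by rewrite ltnS (leq_trans (max_card _)) // card_ord.
rewrite sumr_const card_ord -[leLHS]mulr_natl mulrA -/S.
rewrite ler_wpM2r ?exprn_ge0 ?(ltW th0) // mulrA ler_wpM2r //.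
by rewrite lerDl.
Qed.

(** * Spectral coordinates of a real symmetric matrix *)

(* [c i v] stands for the modulus of the [i]-th coordinate of [v] in an
   orthonormal eigenbasis of [H]; only moduli are recorded because the
   diagonalization in the library is over a closed field, so the basis is
   complex. *)
Record spectral_coords (R : rcfType) (n : nat) (H : 'M[R]_n)
    (lam : 'I_n -> R) (c : 'I_n -> 'rV[R]_n -> R) : Prop := SpectralCoords {
  coord_ge0 : forall i v, 0 <= c i v;
  coordD : forall i v w, c i (v + w) <= c i v + c i w;
  coordH : forall i a b v,
    c i (a *: v + b *: (v *m H)) = `|a + b * lam i| * c i v;
  coord_sum2 : forall v, \sum_i c i v ^+ 2 = (v *m v^T) 0 0;
  coord_qform : forall v, \sum_i lam i * c i v ^+ 2 = (v *m H *m v^T) 0 0;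
  coord_eigen : forall i, exists2 v : 'rV[R]_n, v != 0 & v *m H = lam i *: v }.

(** Over [R[i]] the matrix is hermitian, hence unitarily diagonalizable with real eigenvalues; the
    coordinates of [v] are the entries of [v *m Pc], where [Pc] is the conjugate transpose of the
    unitary [P]. *)
Lemma spectral_coords_exist (R : rcfType) (n : nat) (H : 'M[R]_n) : H^T = H ->
  exists (lam : 'I_n -> R) (c : 'I_n -> 'rV[R]_n -> R), spectral_coords H lam c.
Proof.
move=> Hs.
pose Cx m k (M : 'M[R]_(m, k)) := map_mx (real_complex R) M.
pose nrm := @Normc.normc R.
have nrmE z : (nrm z)%:C%C = `|z| by [].
have nrm2 z : ((nrm z) ^+ 2)%:C%C = z * Num.conj z :> R[i].
  by rewrite rmorphXn /= nrmE normCK.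
have Cxr m k (M : 'M[R]_(m, k)) : map_mx Num.conj (Cx m k M) = Cx m k M.
  apply/matrixP => i j; rewrite !mxE conj_Creal //.
  by apply/complex_realP; eexists.
have Ah : Cx _ _ H \is hermsymmx.
  apply/is_hermitianmxP; rewrite expr0 scale1r -[RHS]/((Cx _ _ H)^T ^ Num.conj)%sesqui.
  by rewrite -map_trmx Cxr /Cx map_trmx Hs.
have Dr := hermitian_spectral_diag_real Ah.
have /orthomx_spectralP An := hermitian_normalmx Ah.
have Pu := spectral_unitarymx (Cx _ _ H).
move: (spectral_diag _) (spectralmx _) An Pu Dr => D P AE Pu Dr.
rewrite invmx_unitary // in AE.
pose Pc := map_mx Num.conj (P^T).
have PPc : P *m Pc = 1%:M by apply/unitarymxP.
have PcP : Pc *m P = 1%:M by apply: mulmx1C.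
rewrite -/Pc in AE.
pose lam i := complex.Re (D 0 i).
have lamE i : (lam i)%:C%C = D 0 i by rewrite RRe_real //; exact: (mxOverP Dr).
pose Y (v : 'rV[R]_n) := Cx _ _ v *m Pc.
have Yc v : map_mx Num.conj (Y v)^T = P *m Cx _ _ v^T.
  rewrite /Y trmx_mul map_mxM /= /Pc map_trmx trmxK -map_mx_comp.
  rewrite -map_trmx Cxr /Cx map_trmx; congr (_ *m _).
  by apply/matrixP => i j; rewrite !mxE /= conjCK.
have YH v : Y (v *m H) = Y v *m diag_mx D.
  rewrite /Y /Cx map_mxM -/(Cx _ _ v) -/(Cx _ _ H) AE.
  by rewrite -!mulmxA PPc mulmx1.
have YHE v i : Y (v *m H) 0 i = (lam i)%:C%C * Y v 0 i.
  by rewrite YH mul_mx_diag mxE lamE mulrC.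
have Yj v i : (map_mx Num.conj (Y v)^T) i 0 = Num.conj (Y v 0 i).
  by rewrite [LHS]mxE; congr Num.conj; rewrite [LHS]mxE.
have YD v w : Y (v + w) = Y v + Y w by rewrite /Y /Cx map_mxD mulmxDl.
have YZ a v : Y (a *: v) = a%:C%C *: Y v by rewrite /Y /Cx map_mxZ -scalemxAl.
exists lam, (fun i v => nrm (Y v 0 i)); split.
- by move=> i v; rewrite -lecR nrmE; exact: normr_ge0.
- move=> i v w; rewrite -lecR rmorphD /= !nrmE YD mxE; exact: ler_normD.
- move=> i a b v; rewrite YD !YZ mxE [X in X + _]mxE [X in _ + X]mxE YHE mulrA -mulrDl.
  rewrite /nrm Normc.normcM; congr (_ * _).
  by rewrite -rmorphM -rmorphD /= expr0n addr0 sqrtr_sqr.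
- move=> v; apply: (@complexI R); rewrite rmorph_sum /=.
  have -> : ((v *m v^T) 0 0)%:C%C = (Y v *m map_mx Num.conj (Y v)^T) 0 0.
    by rewrite Yc /Y mulmxA -(mulmxA _ Pc) PcP mulmx1 -map_mxM [RHS]mxE.
  by rewrite [RHS]mxE; apply: eq_bigr => i _; rewrite nrm2 Yj.
- move=> v; apply: (@complexI R); rewrite rmorph_sum /=.
  have -> : ((v *m H *m v^T) 0 0)%:C%C =
      (Y (v *m H) *m map_mx Num.conj (Y v)^T) 0 0.
    by rewrite Yc /Y mulmxA -(mulmxA _ Pc) PcP mulmx1 -map_mxM [RHS]mxE.
  rewrite [RHS]mxE; apply: eq_bigr => i _.
  by rewrite rmorphM /= nrm2 YHE Yj mulrA.
(* As [H] and [lam i] are real, the real and imaginary parts of row [i] of [P] both satisfy the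
   eigenvector equation; they cannot both vanish because [P] is invertible. *)
move=> i; pose p := row i P.
have pA : p *m Cx _ _ H = (lam i)%:C%C *: p.
  rewrite /p -row_mul AE !mulmxA PPc mul1mx row_mul row_diag_mx -scalemxAl.
  by rewrite -rowE lamE.
pose pr : 'rV[R]_n := map_mx (@complex.Re R) p.
pose pi : 'rV[R]_n := map_mx (@complex.Im R) p.
have [prH piH] : pr *m H = lam i *: pr /\ pi *m H = lam i *: pi.
  split; apply/rowP => j; move/rowP/(_ j): pA; rewrite !mxE => pA.
    have -> : lam i * complex.Re (P i j) = complex.Re ((lam i)%:C%C * P i j).
      by case: (P i j) => a b /=; rewrite mul0r subr0.
    rewrite -pA raddf_sum; apply: eq_bigr => k _; rewrite !mxE.
    by case: (P i k) => a b /=; rewrite mulr0 subr0.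
  have -> : lam i * complex.Im (P i j) = complex.Im ((lam i)%:C%C * P i j).
    by case: (P i j) => a b /=; rewrite mul0r addr0.
  rewrite -pA raddf_sum; apply: eq_bigr => k _; rewrite !mxE.
  by case: (P i k) => a b /=; rewrite mulr0 add0r.
have [pr0|] := eqVneq pr 0; last by exists pr.
have [pi0|] := eqVneq pi 0; last by exists pi.
have p0 : p = 0.
  apply/rowP => j; move/rowP/(_ j): pr0; move/rowP/(_ j): pi0.
  by rewrite !mxE; case: (P i j) => a b /= -> ->.
have : row i (P *m Pc) = 0 by rewrite row_mul -/p p0 mul0mx.
rewrite PPc => /rowP/(_ i); rewrite !mxE eqxx => /eqP.
by rewrite oner_eq0.
Qed.

(** * Directional derivatives and local expansions *)

(** The two difference quotients are the same function, so calculus along a line reduces to one real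
    variable. *)
Lemma is_derive_line (R : realType) (V : normedModType R) (f : V -> R)
    (x v : V) (t d : R) :
  is_derive t 1 (fun h : R => f (x + h *: v)) d <->
  is_derive (x + t *: v) v f d.
Proof.
suff E : (fun h : R => h^-1 *: ((f \o shift (x + t *: v)) (h *: v) - f (x + t *: v)))
       = (fun h : R => h^-1 *: (((fun h : R => f (x + h *: v)) \o shift t) (h *: (1 : R))
            - f (x + t *: v))).
  by split=> -[h1 h2]; split; move: h1 h2; rewrite /derivable /derive E.
apply/funext => h /=; congr (_ *: (f _ - _)).
by rewrite [h *: 1]mulr1 scalerDl addrCA.
Qed.

Lemma is_derive_dirZ (R : realType) (V : normedModType R) (f : V -> R)
    (x v : V) (a d : R) :
  is_derive x v f d -> is_derive x (a *: v) f (a * d).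
Proof.
move=> fd; rewrite -[x]addr0 -(scale0r (a *: v)); apply/is_derive_line.
have fd' : is_derive (a * 0) 1 (fun h : R => f (x + h *: v)) d.
  by apply/is_derive_line; rewrite mulr0 scale0r addr0.
have -> : (fun h : R => f (x + h *: (a *: v))) =
    (fun h : R => f (x + h *: v)) \o (fun h => a * h).
  by apply/funext => h /=; rewrite scalerA mulrC.
have ad : is_derive (0 : R) 1 (fun h : R => a * h) a.
  by apply: is_derive_eq; rewrite [_ *: _]mulr1.
rewrite mulrC; exact: is_derive1_comp fd' ad.
Qed.

Lemma MVT_dir (R : realType) (V : normedModType R) (f : V -> R) (v : V)
    (D : V -> R) : (forall y, is_derive y v f (D y)) ->
  forall x, exists2 s : R, 0 <= s <= 1 & f (x + v) - f x = D (x + s *: v).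
Proof.
move=> fD x; pose g (h : R) := f (x + h *: v).
have gd (t : R) : is_derive t (1 : R) g (D (x + t *: v)) by apply/is_derive_line.
have [|s] := @MVT_segment R g (fun t => D (x + t *: v)) 0 1 ler01.
- by apply: derivable_within_continuous => t _.
- rewrite in_itv /= => s01 E; exists s => //.
  by move: E; rewrite /g scale1r scale0r addr0 subr0 mulr1.
Qed.

(** [Ck] only speaks of coordinate directions; this allows them to be summed. The increment along
    [u + w] is split at [h *: w + x]: its part along [u] has a moving base point and is handled by
    the mean value theorem and the continuity of [Du]. *)
Lemma is_derive_dirD (R : realType) (V : normedModType R) (f : V -> R) (u w : V)
    (Du Dw : V -> R) :
  (forall x, is_derive x u f (Du x)) -> (forall x, is_derive x w f (Dw x)) ->
  continuous Du -> forall x, is_derive x (u + w) f (Du x + Dw x).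
Proof.
move=> fu fw cDu x.
have h1 : (fun h : R => h^-1 *: (f (h *: u + (h *: w + x)) - f (h *: w + x)))
    @ 0^' --> Du x.
  apply/cvgrPdist_le => /= e e0.
  have /cvgrPdist_le/(_ e e0) := cDu x.
  rewrite near_nbhs => /nbhs_ballP[d /= d0 hd].
  near=> h.
  have hn0 : h != 0 by near: h; exact: nbhs_dnbhs_neq.
  have [s /andP[s0 s1]] := MVT_dir (fun y => is_derive_dirZ h (fu y)) (h *: w + x).
  rewrite (addrC _ (h *: u)) => ->.
  rewrite [_ *: _]mulrA mulVf // mul1r; apply: hd.
  rewrite -ball_normE /=.
  have -> : x - (h *: w + x + s *: (h *: u)) = - (h *: (w + s *: u)).
    by rewrite (addrC _ x) -addrA opprD addrA subrr sub0r scalerDr !scalerA (mulrC h s).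
  rewrite normrN normrZ.
  have wu : `|w + s *: u| <= `|w| + `|u|.
    apply: (le_trans (ler_normD _ _)); rewrite lerD2l normrZ ger0_norm //.
    by rewrite ler_piMl.
  have hlt : `|h| < d / (`|w| + `|u| + 1).
    by near: h; apply: dnbhs0_lt; rewrite divr_gt0 // addr_ge0 ?addr_ge0.
  have p0 : 0 < `|w| + `|u| + 1 by rewrite ltr_wpDl ?addr_ge0.
  move: hlt; rewrite ltr_pdivlMr // => hlt.
  apply: le_lt_trans hlt; rewrite ler_wpM2l //.
  by apply: (le_trans wu); rewrite lerDl.
have [h2 h2'] := fw x.
have {h2'} h2 : (fun h : R => h^-1 *: (f (h *: w + x) - f x)) @ 0^' --> Dw x.
  by rewrite -h2'; exact: h2.
have h3 : (fun h : R => h^-1 *: (f (h *: (u + w) + x) - f x)) @ 0^' --> Du x + Dw x.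
  rewrite (_ : (fun h : R => _) =
      (fun h : R => h^-1 *: (f (h *: u + (h *: w + x)) - f (h *: w + x)))
      \+ (fun h : R => h^-1 *: (f (h *: w + x) - f x))).
    exact: cvgD h1 h2.
  by apply/funext => h /=; rewrite -scalerDr (scalerDr h u w) -(addrA (h *: u)) subrKA.
by apply: DeriveDef; [apply/cvg_ex; exists (Du x + Dw x) | apply/cvg_lim].
Unshelve. all: by end_near. Qed.

(** * Euclidean inner product and norms *)

Definition dotp (R : realType) (n : nat) (u v : 'rV[R]_n) : R := (u *m v^T) 0 0.

Section Euclidean.
Variables (R : realType) (n : nat).
Implicit Types (u v w : 'rV[R]_n) (a : R).

Lemma dotpE u v : dotp u v = \sum_i u 0 i * v 0 i.
Proof. by rewrite /dotp mxE; apply: eq_bigr => i _; rewrite mxE. Qed.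

Lemma dotpC u v : dotp u v = dotp v u.
Proof. by rewrite !dotpE; apply: eq_bigr => i _; rewrite mulrC. Qed.

Lemma dotpDl u v w : dotp (u + v) w = dotp u w + dotp v w.
Proof. by rewrite /dotp mulmxDl mxE. Qed.

Lemma dotpDr u v w : dotp w (u + v) = dotp w u + dotp w v.
Proof. by rewrite dotpC dotpDl !(dotpC w). Qed.

Lemma dotpZl a u w : dotp (a *: u) w = a * dotp u w.
Proof. by rewrite /dotp -scalemxAl mxE. Qed.

Lemma dotpZr a u w : dotp w (a *: u) = a * dotp w u.
Proof. by rewrite dotpC dotpZl dotpC. Qed.

Lemma dotpNl u w : dotp (- u) w = - dotp u w.
Proof. by rewrite -scaleN1r dotpZl mulN1r. Qed.

Lemma dotpNr u w : dotp w (- u) = - dotp w u.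
Proof. by rewrite dotpC dotpNl dotpC. Qed.

Lemma norm2_ge0 v : 0 <= norm2 v.
Proof. exact: sqrtr_ge0. Qed.

Lemma sqr_norm2 v : norm2 v ^+ 2 = dotp v v.
Proof.
rewrite /norm2 sqr_sqrtr; first by rewrite dotpE; apply: eq_bigr => i _.
by apply: sumr_ge0 => i _; exact: sqr_ge0.
Qed.

Lemma norm2_eq0 v : (norm2 v == 0) = (v == 0).
Proof.
apply/idP/eqP => [/eqP v0|->]; last first.
  by rewrite /norm2 big1 ?sqrtr0 // => i _; rewrite mxE expr0n.
have : dotp v v = 0 by rewrite -sqr_norm2 v0 expr0n.
rewrite dotpE => /psumr_eq0P h; apply/rowP => i; rewrite mxE; apply/eqP.
by rewrite -sqrf_eq0 expr2; apply/eqP/h => // j _; rewrite -expr2 sqr_ge0.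
Qed.

Lemma norm20 : norm2 (0 : 'rV[R]_n) = 0.
Proof. by apply/eqP; rewrite norm2_eq0. Qed.

Lemma norm2Z a v : norm2 (a *: v) = `|a| * norm2 v.
Proof.
apply/eqP; rewrite -(@eqrXn2 _ 2) ?norm2_ge0 ?mulr_ge0 ?norm2_ge0 //.
by rewrite exprMn !sqr_norm2 dotpZl dotpZr mulrA -expr2 real_normK ?num_real.
Qed.

Lemma norm2N v : norm2 (- v) = norm2 v.
Proof. by rewrite -scaleN1r norm2Z normrN1 mul1r. Qed.

(** Cauchy-Schwarz, by expanding the squared norm of [norm2 v ^+ 2 *: u - dotp u v *: v]. *)
Lemma dotp_le u v : `|dotp u v| <= norm2 u * norm2 v.
Proof.
have [v0|vN0] := eqVneq v 0.
  by rewrite v0 /dotp trmx0 mulmx0 mxE normr0 norm20 mulr0.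
have v0 : 0 < norm2 v by rewrite lt_def norm2_eq0 vN0 norm2_ge0.
rewrite -(@ler_pXn2r _ 2) ?nnegrE ?mulr_ge0 ?norm2_ge0 //.
rewrite real_normK ?num_real // exprMn.
have := sqr_ge0 (norm2 (norm2 v ^+ 2 *: u - dotp u v *: v)).
rewrite [leRHS]sqr_norm2 dotpDl !dotpDr !dotpNl !dotpNr !dotpZl !dotpZr (dotpC v u).
rewrite -!sqr_norm2 => h.
rewrite -(ler_pM2l (exprn_gt0 2 v0)); lra.
Qed.

Lemma norm2D u v : norm2 (u + v) <= norm2 u + norm2 v.
Proof.
rewrite -(@ler_pXn2r _ 2) ?nnegrE ?addr_ge0 ?norm2_ge0 //.
rewrite sqr_norm2 dotpDl !dotpDr (dotpC v u) -!sqr_norm2.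
have := le_trans (ler_norm _) (dotp_le u v); lra.
Qed.

Lemma norm2B u v : norm2 (u - v) <= norm2 u + norm2 v.
Proof. by rewrite -(norm2N v); exact: norm2D. Qed.

Lemma opnorm2P (A : 'M[R]_n) v : norm2 (v *m A^T) <= opnorm2 A * norm2 v.
Proof.
have [v0|vN0] := eqVneq v 0.
  by rewrite v0 mul0mx norm20 mulr0.
have v0 : 0 < norm2 v by rewrite lt_def norm2_eq0 vN0 norm2_ge0.
(* The Frobenius norm of [A] bounds the set in [opnorm2], so that its supremum really is an upper
   bound. *)
have bd (w : 'rV[R]_n) : norm2 w <= 1 ->
    norm2 (w *m A^T) <= Num.sqrt (\sum_i norm2 (row i A) ^+ 2).
  move=> w1; rewrite /norm2 ler_wsqrtr //; apply: ler_sum => i _.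
  have -> : (w *m A^T) 0 i = dotp w (row i A).
    by rewrite dotpE mxE; apply: eq_bigr => j _; rewrite !mxE.
  rewrite -(real_normK (num_real (dotp _ _))) -/(norm2 (row i A)).
  rewrite ler_pXn2r ?nnegrE ?norm2_ge0 //.
  by apply: (le_trans (dotp_le _ _)); rewrite ler_piMl // norm2_ge0.
rewrite -ler_pdivrMr //.
have -> : norm2 (v *m A^T) / norm2 v = norm2 (((norm2 v)^-1 *: v) *m A^T).
  by rewrite -scalemxAl norm2Z ger0_norm ?invr_ge0 ?norm2_ge0 // mulrC.
apply: ub_le_sup.
  by exists (Num.sqrt (\sum_i norm2 (row i A) ^+ 2)) => _ [w /= w1 <-]; exact: bd.
exists ((norm2 v)^-1 *: v) => //=.
by rewrite norm2Z ger0_norm ?invr_ge0 ?norm2_ge0 // mulVf // gt_eqF.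
Qed.

Lemma norm2_ge_norm v : `|v| <= norm2 v.
Proof.
rewrite [leLHS]/Num.Def.normr/= mx_normrE.
apply/bigmax_leP; split => [|[i j] _]; first exact: norm2_ge0.
rewrite (ord1 i) /= -(@ler_pXn2r _ 2) ?nnegrE ?norm2_ge0 //.
rewrite real_normK ?num_real // sqr_norm2 dotpE (bigD1 j) //= lerDl.
by apply: sumr_ge0 => k _; exact: sqr_ge0.
Qed.

Lemma eball_line (xs x v : 'rV[R]_n) (d s : R) : 0 <= s <= 1 ->
  eball xs d x -> eball xs d (x + v) -> eball xs d (x + s *: v).
Proof.
move=> /andP[s0 s1]; rewrite /eball /= => hx hv.
have -> : x + s *: v - xs = (1 - s) *: (x - xs) + s *: (x + v - xs).
  apply/rowP => i; rewrite !mxE; ring.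
apply: le_lt_trans (norm2D _ _) _; rewrite !norm2Z !ger0_norm ?subr_ge0 //.
have [->|sN0] := eqVneq s 0; first by rewrite mul0r addr0 subr0 mul1r.
have {}s0 : 0 < s by rewrite lt_def sN0.
have h1 : (1 - s) * norm2 (x - xs) <= (1 - s) * d.
  by rewrite ler_wpM2l ?subr_ge0 // ltW.
have h2 : s * norm2 (x + v - xs) < s * d by rewrite ltr_pM2l.
lra.
Qed.

End Euclidean.

(** * Derivatives expressed by gradient and Hessian *)

Section Gradient.
Variables (R : realType) (n : nat).

Lemma Ck1_dir (k : nat) (f : 'rV[R]_n -> R) (v x : 'rV[R]_n) : Ck k.+1 f ->
  is_derive x v f (dotp (grad f x) v).
Proof.
move=> [_ Cf].
have fp i y : is_derive y (delta_mx 0 i) f (partial i f y).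
  by have [/(_ y) + _] := Cf i; exact: derivableP.
have cp i : continuous (partial i f).
  by have [_] := Cf i; case: (k) => [|?] [].
(* Coordinate directions are added one at a time, each having a continuous derivative. *)
suff H (r : seq 'I_n) : forall y, is_derive y (\sum_(i <- r) v 0 i *: delta_mx 0 i) f
    (\sum_(i <- r) v 0 i * partial i f y).
  have := H (index_enum 'I_n) x; rewrite -row_sum_delta => h.
  have -> // : dotp (grad f x) v = \sum_(i <- index_enum 'I_n) v 0 i * partial i f x.
  by rewrite dotpE; apply: eq_bigr => i _; rewrite mxE mulrC.
elim: r => [|i r IHr] y.
  by rewrite !big_nil; exact: is_derive0.
rewrite !big_cons.
apply: (is_derive_dirD (Du := fun y => v 0 i * partial i f y)
  (Dw := fun y => \sum_(i <- r) v 0 i * partial i f y)).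
- by move=> z; exact: is_derive_dirZ.
- by move=> z; exact: (cvgM (cvg_cst (v 0 i)) (cp i z)).
Qed.

Lemma Ck2_grad_dir (k : nat) (f : 'rV[R]_n -> R) (v w x : 'rV[R]_n) : Ck k.+2 f ->
  is_derive x v (fun y => dotp w (grad f y)) (dotp w (v *m (hess f x)^T)).
Proof.
move=> [_ Cf].
have E : (fun y => dotp w (grad f y)) = \sum_i (fun y => w 0 i *: partial i f y).
  by apply/funext => y; rewrite dotpE fct_sumE; apply: eq_bigr => i _; rewrite mxE.
rewrite E.
have -> : dotp w (v *m (hess f x)^T) = \sum_i w 0 i *: dotp (grad (partial i f) x) v.
  rewrite dotpE; apply: eq_bigr => i _; congr (_ * _).
  by rewrite mxE dotpE; apply: eq_bigr => j _; rewrite !mxE mulrC.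
apply: is_derive_sum => i.
by apply: is_deriveZ; have [_] := Cf i; exact: Ck1_dir.
Qed.

End Gradient.

Lemma self_adjoint_sym (R : realType) (n : nat) (A : 'M[R]_n) :
  (forall u v, dotp u (v *m A) = dotp v (u *m A)) -> A = A^T.
Proof.
have dl (j : 'I_n) (v : 'rV[R]_n) : dotp (delta_mx 0 j) v = v 0 j.
  rewrite dotpE (bigD1 j) //= big1 => [|k kj].
    by rewrite mxE !eqxx mul1r addr0.
  by rewrite mxE (negbTE kj) mul0r.
move=> sym; apply/matrixP => i j.
by have := sym (delta_mx 0 j) (delta_mx 0 i); rewrite !dl -!rowE !mxE.
Qed.

(** * First and second order expansions *)

Section Expansion.
Variables (R : realType) (n : nat) (f : 'rV[R]_n -> R).
Hypothesis f2 : Ck 2 f.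

(** Fermat's rule along the direction [grad f xs] itself, where the derivative is the squared norm
    of the gradient. *)
Lemma grad_min (xs : 'rV[R]_n) : (forall x, f xs <= f x) -> grad f xs = 0.
Proof.
move=> fmin; pose v := grad f xs.
have gd (t : R) : is_derive t (1 : R) (fun h : R => f (xs + h *: v))
    (dotp (grad f (xs + t *: v)) v).
  by apply/is_derive_line; exact: Ck1_dir f2.
have m1 : (-1 : R) <= 1 by rewrite (le_trans (lerN10 R)).
have m2 : (0 : R) \in `]-1, 1[ by rewrite in_itv /= ltrN10 ltr01.
have [t _|t _|_ g0] := @derive1_at_min R (fun h : R => f (xs + h *: v)) _ _ _ m1 _ m2.
- by have [] := gd t.
- by rewrite scale0r addr0; exact: fmin.
have [_ gd0] := gd 0; move: gd0; rewrite g0 scale0r addr0 => v0.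
by apply/eqP; rewrite -norm2_eq0 -sqrf_eq0 sqr_norm2 v0.
Qed.

Section Ball.
Variables (xs : 'rV[R]_n) (d E : R) (H : 'M[R]_n).
Hypothesis E0 : 0 <= E.
Hypothesis hessE : forall x v, eball xs d x ->
  norm2 (v *m (hess f x)^T - v *m H^T) <= E * norm2 v.

(** The mean value theorem is scalar, so it is applied to the gradient paired with the error vector
    [w] itself; a factor [norm2 w] then cancels. *)
Lemma grad_expand (y s : 'rV[R]_n) : eball xs d y -> eball xs d (y + s) ->
  norm2 (grad f (y + s) - grad f y - s *m H^T) <= E * norm2 s.
Proof.
move=> yd ysd; set w := _ - _.
have [t t01] := MVT_dir (fun z => Ck2_grad_dir s w z f2) y.
rewrite -dotpNr -dotpDr => e.
have : dotp w w <= norm2 w * (E * norm2 s).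
  rewrite {2}/w dotpDr e -dotpDr.
  apply: le_trans (ler_norm _) _; apply: le_trans (dotp_le _ _) _.
  by rewrite ler_wpM2l ?norm2_ge0 // hessE //; exact: eball_line.
rewrite -sqr_norm2 expr2; have [->|wN0] := eqVneq (norm2 w) 0.
  by move=> _; rewrite mulr_ge0 ?norm2_ge0.
by rewrite ler_pM2l // lt_def wN0 norm2_ge0.
Qed.

(** Mean value theorem for [f] minus its quadratic model along the segment; the derivative of the
    difference is controlled by [grad_expand]. *)
Lemma value_expand (y s : 'rV[R]_n) : eball xs d y -> eball xs d (y + s) ->
  `|f (y + s) - f y - dotp (grad f y) s - 2^-1 * dotp s (s *m H^T)|
    <= E * norm2 s ^+ 2.
Proof.
move=> yd ysd.
pose g (t : R) := f (y + t *: s) - (t * dotp (grad f y) s + t ^+ 2 * (2^-1 * dotp s (s *m H^T))).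
have gd (t : R) : is_derive t (1 : R) g
   (dotp (grad f (y + t *: s) - grad f y - (t *: s) *m H^T) s).
  have h : is_derive t (1 : R) (fun h : R => f (y + h *: s))
      (dotp (grad f (y + t *: s)) s).
    by apply/is_derive_line; exact: Ck1_dir f2.
  apply: is_derive_eq.
  rewrite !dotpDl !dotpNl -scalemxAl dotpZl (dotpC (s *m _)).
  by rewrite /GRing.scale /=; field.
have cg : {within `[0, 1], continuous g}.
  by apply: derivable_within_continuous => z _; have [] := gd z.
have [t] := MVT_segment ler01 (fun t _ => gd t) cg.
rewrite in_itv /= => t01.
rewrite /g !scale1r scale0r addr0 subr0 !mul0r expr1n expr0n /= !mul1r mul0r addr0 subr0 mulr1.
move=> e.
rewrite (_ : _ - _ =
    dotp (grad f (y + t *: s) - grad f y - (t *: s) *m H^T) s); last first.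
  by rewrite -e; ring.
apply: le_trans (dotp_le _ _) _; rewrite expr2 mulrA ler_wpM2r ?norm2_ge0 //.
apply: le_trans (grad_expand _ _) _ => //; first exact: eball_line.
rewrite ler_wpM2l // norm2Z; case/andP: t01 => t0 t1.
by rewrite ger0_norm // ler_piMl ?norm2_ge0.
Qed.

(** Mean value theorem in direction [u] for [z |-> f (z + w) - f z], whose derivative is a gradient
    difference. *)
Lemma second_difference (y u w : 'rV[R]_n) : eball xs d y ->
  eball xs d (y + u) -> eball xs d (y + w) -> eball xs d (y + u + w) ->
  `|f (y + u + w) - f (y + u) - (f (y + w) - f y) - dotp u (w *m H^T)|
    <= E * norm2 u * norm2 w.
Proof.
move=> hy hu hw huw.
have fd z : is_derive z u (fun z => f (z + w) - f z)
    (dotp (grad f (z + w) - grad f z) u).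
  have h1 : is_derive z u (fun z => f (z + w)) (dotp (grad f (z + w)) u).
    have := Ck1_dir u (z + w) f2.
    rewrite -[z + w]addr0 -(scale0r u) => /is_derive_line h.
    rewrite -[z in is_derive z]addr0 -(scale0r u); apply/is_derive_line.
    suff -> : (fun h : R => f (z + h *: u + w)) = (fun h : R => f (z + w + h *: u)) by [].
    by apply/funext => k; rewrite addrAC.
  have h2 := Ck1_dir u z f2.
  by rewrite dotpDl dotpNl; apply: is_deriveB.
have [t t01 ->] := MVT_dir fd y.
rewrite (dotpC u) -dotpNl -dotpDl.
apply: le_trans (dotp_le _ _) _; rewrite mulrAC ler_wpM2r ?norm2_ge0 //.
apply: grad_expand; first exact: eball_line.
by rewrite addrAC; apply: eball_line => //; rewrite addrAC.
Qed.

End Ball.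

(* Both orders of differentiation are limits of the same second difference. *)
Lemma hess_sym (xs : 'rV[R]_n) (rho L : R) : 0 < rho -> 0 <= L ->
  (forall d x v, 0 < d <= rho -> eball xs d x ->
     norm2 (v *m (hess f x)^T - v *m (hess f xs)^T) <= L * d * norm2 v) ->
  (hess f xs)^T = hess f xs.
Proof.
move=> rho0 L0 hL; set H := hess f xs.
suff sym u w : dotp u (w *m H^T) = dotp w (u *m H^T).
  by rewrite -[in RHS](trmxK H); exact: self_adjoint_sym.
(* The summand 1 puts the corners of the parallelogram strictly inside the ball of radius [t * c].
   There the Hessian deviates from [H] by at most [L * (t * c)], which makes the error in [bnd]
   cubic in [t]. *)
pose c := norm2 u + norm2 w + 1.
have c0 : 0 < c by rewrite ltr_wpDl // addr_ge0 ?norm2_ge0.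
have bnd (a b : 'rV[R]_n) (t : R) : norm2 a + norm2 b + 1 = c -> 0 < t -> t * c <= rho ->
   `|f (xs + t *: a + t *: b) - f (xs + t *: a) - (f (xs + t *: b) - f xs)
      - t ^+ 2 * dotp a (b *m H^T)| <= L * c ^+ 3 * t ^+ 3.
  move=> abc t0 tc.
  have tc0 : 0 < t * c by rewrite mulr_gt0.
  have ball (z : 'rV[R]_n) : norm2 z <= norm2 a + norm2 b -> eball xs (t * c) (xs + t *: z).
    move=> zc; rewrite /eball /= addrC addKr norm2Z gtr0_norm // ltr_pM2l //.
    by apply: le_lt_trans zc _; rewrite -abc ltrDl.
  have LL0 : 0 <= L * (t * c) by rewrite mulr_ge0 // ltW.
  have tcr : 0 < t * c <= rho by rewrite tc0.
  have h := second_difference LL0 (fun x v => hL (t * c) x v tcr) (y := xs)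
    (u := t *: a) (w := t *: b).
  move: h; rewrite dotpZl -scalemxAl dotpZr mulrA -expr2 !norm2Z (gtr0_norm t0) => h.
  apply: le_trans (h _ _ _ _) _.
  - by have := ball 0; rewrite scaler0 addr0 norm20 addr_ge0 ?norm2_ge0 //; apply.
  - by apply: ball; rewrite lerDl norm2_ge0.
  - by apply: ball; rewrite lerDr norm2_ge0.
  - by rewrite -addrA -scalerDr; apply: ball; exact: norm2D.
  have an : norm2 a <= c by rewrite -abc; have := norm2_ge0 b; lra.
  have bn : norm2 b <= c by rewrite -abc; have := norm2_ge0 a; lra.
  have -> : L * (t * c) * (t * norm2 a) * (t * norm2 b) =
      L * c * t ^+ 3 * (norm2 a * norm2 b) by ring.
  have -> : L * c ^+ 3 * t ^+ 3 = L * c * t ^+ 3 * (c * c) by ring.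
  rewrite ler_wpM2l ?mulr_ge0 ?exprn_ge0 ?(ltW t0) ?(ltW c0) //.
  by rewrite ler_pM ?norm2_ge0.
(* Apply [bnd] in both orders and divide by [t ^+ 2]: a bound linear in [t] remains. *)
have lim t : 0 < t -> t * c <= rho ->
   `|dotp u (w *m H^T) - dotp w (u *m H^T)| <= 2 * L * c ^+ 3 * t.
  move=> t0 tc.
  have h1 := bnd u w t erefl t0 tc.
  have h2 := bnd w u t (congr1 (+%R^~ 1) (addrC _ _)) t0 tc.
  rewrite -(ler_pM2l (exprn_gt0 2 t0)) -[X in X * `|_|](ger0_norm (sqr_ge0 t)) -normrM.
  rewrite (addrAC xs (t *: w)) in h2.
  move/ler_normlP: h1 => [h1 h1']; move/ler_normlP: h2 => [h2 h2'].
  have -> : t ^+ 2 * (2 * L * c ^+ 3 * t) = 2 * (L * c ^+ 3 * t ^+ 3) by ring.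
  rewrite ler_norml; apply/andP; split; lra.
apply/eqP; rewrite -subr_eq0 -normr_le0; apply/ler_addgt0Pl => e e0.
rewrite addr0.
pose t := Num.min (rho / c) (e / (2 * L * c ^+ 3 + 1)).
have p0 : 0 < 2 * L * c ^+ 3 + 1 by rewrite ltr_wpDl // !mulr_ge0 ?exprn_ge0 // ltW.
have t0 : 0 < t by rewrite lt_min !divr_gt0.
have tc : t * c <= rho by rewrite -ler_pdivlMr // ge_min lexx.
apply: le_trans (lim t t0 tc) _.
have : t * (2 * L * c ^+ 3 + 1) <= e by rewrite -ler_pdivlMr // ge_min lexx orbT.
lra.
Qed.

End Expansion.

(** * Local behaviour of the step-sizes *)

(* The step [N / M] approximates the inverse of the mean of [lam] under the
   weights [q]: squared coordinates [c i s ^+ 2] for the long step-size, and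
   [lam i * c i s ^+ 2] for the short one. *)
Lemma rayleigh_step (R : realFieldType) (n : nat) (lam q : 'I_n -> R)
    (l U zeta N M : R) :
  0 < l -> (forall i, l <= lam i <= U) -> (forall i, 0 <= q i) ->
  0 < \sum_i q i -> zeta <= 16^-1 -> zeta <= l / 8 ->
  `|N - \sum_i q i| <= zeta * \sum_i q i ->
  `|M - \sum_i lam i * q i| <= zeta * \sum_i q i ->
  [/\ (4 * U)^-1 <= N / M, N / M <= 3 / l &
      forall i, \sum_(j | lam j < lam i) q j <= 8^-1 * \sum_j q j ->
        N / M * lam i <= 3 / 2].
Proof.
move=> l0 hlam q0; set Q := \sum_i q i => Q0 z1 z2 /ler_normlP[hN hN'].
set W := \sum_i _ => /ler_normlP[hM hM'].
have lU : l <= U.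
  case: (pickP (fun i : 'I_n => true)) => [i _|i0].
    by have /andP[h1 h2] := hlam i; exact: le_trans h2.
  by move: Q0; rewrite /Q big1 ?ltxx // => i; have := i0 i.
have U0 : 0 < U by apply: lt_le_trans lU.
have WU : W <= U * Q.
  rewrite mulr_sumr; apply: ler_sum => i _.
  by rewrite ler_wpM2r //; case/andP: (hlam i).
have Wl : l * Q <= W.
  rewrite mulr_sumr; apply: ler_sum => i _.
  by rewrite ler_wpM2r //; case/andP: (hlam i).
have lQ0 : 0 < l * Q by rewrite mulr_gt0.
have lUQ : l * Q <= U * Q by rewrite ler_wpM2r // ltW.
have h1 : zeta * Q <= 16^-1 * Q by rewrite ler_wpM2r // ltW.
have h2 : zeta * Q <= l / 8 * Q by rewrite ler_wpM2r // ltW.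
have M0 : 0 < M by lra.
split.
- rewrite ler_pdivlMr // mulrC ler_pdivrMr ?mulr_gt0 //.
  have : U * Q * (1/2) <= U * N by rewrite -mulrA ler_wpM2l ?(ltW U0) //; lra.
  lra.
- rewrite ler_pdivrMr // mulrAC ler_pdivlMr //.
  have : l * N <= l * (2 * Q) by rewrite ler_wpM2l ?(ltW l0) //; lra.
  lra.
move=> i low; rewrite mulrAC ler_pdivrMr //.
have /andP[li Ui] := hlam i.
(* Small low weights keep the mean large: they cost at most [Q / 8], so [M >= 3/4 * lam i * Q],
   while [N <= 17/16 * Q]; the ratio 17/12 is below 3/2. *)
have Wi : lam i * Q - lam i * (\sum_(j | lam j < lam i) q j) <= W.
  rewrite /Q /W [X in _ * X - _](bigID (fun j => lam j < lam i)) /=.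
  rewrite mulrDr addrC addKr [leRHS](bigID (fun j => lam j < lam i)) /=.
  apply: ler_wpDl.
    by apply: sumr_ge0 => j _; rewrite mulr_ge0 // (le_trans (ltW l0)) //; case/andP: (hlam j).
  by rewrite mulr_sumr; apply: ler_sum => j; rewrite -leNgt => ij; rewrite ler_wpM2r.
have lam0 : 0 < lam i by apply: lt_le_trans li.
have h3 : lam i * (\sum_(j | lam j < lam i) q j) <= lam i * (8^-1 * Q) by rewrite ler_wpM2l // ltW.
have h4 : lam i * N <= lam i * (17 / 16 * Q) by rewrite ler_wpM2l ?(ltW lam0) //; lra.
have h5 : l * Q <= lam i * Q by rewrite ler_wpM2r // ltW.
lra.
Qed.

(** * Norm comparisons in spectral coordinates *)

Section Coords.
Variables (R : realType) (n : nat) (H : 'M[R]_n).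
Variables (lam : 'I_n -> R) (c : 'I_n -> 'rV[R]_n -> R).
Hypothesis spec : spectral_coords H lam c.

Lemma coordZ i a v : c i (a *: v) = `|a| * c i v.
Proof. by rewrite -[a *: v]addr0 -(scale0r (v *m H)) (coordH spec) mul0r addr0. Qed.

Lemma coordN i v : c i (- v) = c i v.
Proof. by rewrite -scaleN1r coordZ normrN1 mul1r. Qed.

Lemma coord_zero i v : c i (v - v) = 0.
Proof. by rewrite subrr -(scale0r v) coordZ normr0 mul0r. Qed.

Lemma sum_coord2 v : \sum_i c i v ^+ 2 = norm2 v ^+ 2.
Proof. by rewrite (coord_sum2 spec) sqr_norm2. Qed.

Lemma coord_le_norm i v : c i v <= norm2 v.
Proof.
rewrite -(@ler_pXn2r _ 2) ?nnegrE ?norm2_ge0 ?(coord_ge0 spec) //.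
rewrite -sum_coord2 (bigD1 i) //= lerDl.
by apply: sumr_ge0 => j _; exact: sqr_ge0.
Qed.

Lemma norm_le_sum_coord v : norm2 v <= \sum_i c i v.
Proof.
have c0 := coord_ge0 spec; have s0 : 0 <= \sum_i c i v by apply: sumr_ge0.
rewrite -(@ler_pXn2r _ 2) ?nnegrE ?norm2_ge0 // -sum_coord2 expr2 mulr_sumr.
apply: ler_sum => i _; rewrite expr2 ler_wpM2r // (bigD1 i) //= lerDl.
exact: sumr_ge0.
Qed.

Lemma sum_coord_le v : \sum_i c i v <= n%:R * norm2 v.
Proof.
apply: (@le_trans _ _ (\sum_(i < n) norm2 v)).
  by apply: ler_sum => i _; exact: coord_le_norm.
by rewrite sumr_const card_ord mulr_natl.
Qed.

Lemma coord_mulH i v : 0 <= lam i -> c i (v *m H) = lam i * c i v.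
Proof.
move=> li; rewrite -[v *m H]add0r -(scale0r v) -[v *m H]scale1r (coordH spec).
by rewrite mul1r add0r ger0_norm.
Qed.

End Coords.

(** * One step of the method near the minimizer *)

Section Step.
Variables (R : realType) (n : nat) (f : 'rV[R]_n -> R) (xs : 'rV[R]_n).
Variables (H : 'M[R]_n) (d E l U : R).
Variables (lam : 'I_n -> R) (c : 'I_n -> 'rV[R]_n -> R).
Hypothesis f2 : Ck 2 f.
Hypothesis gxs : grad f xs = 0.
Hypothesis hessE : forall x v, eball xs d x ->
  norm2 (v *m (hess f x)^T - v *m H^T) <= E * norm2 v.
Hypothesis Hs : H^T = H.
Hypothesis spec : spectral_coords H lam c.
Hypothesis l0 : 0 < l.
Hypothesis lU : l <= U.
Hypothesis lamlU : forall i, l <= lam i <= U.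
Hypothesis d0 : 0 < d.
Hypothesis E0 : 0 <= E.
Hypothesis El2 : E <= l / 2.

Let c_ge0 := coord_ge0 spec.
Let cD := coordD spec.
Let cH := coordH spec.
Let cHc := coord_qform spec.

Let U0 : 0 < U. Proof. exact: lt_le_trans lU. Qed.

Let cZ := coordZ spec.
Let cN := coordN spec.
Let sumc2 := sum_coord2 spec.
Let c_le_norm := coord_le_norm spec.
Let norm_le_sumc := norm_le_sum_coord spec.
Let sumc_le_norm := sum_coord_le spec.

Let cmulH i v : c i (v *m H) = lam i * c i v.
Proof.
apply: (coord_mulH spec).
by case/andP: (lamlU i) => + _; exact: le_trans (ltW l0).
Qed.

Let sumc_ge0 v : 0 <= \sum_i c i v. Proof. by apply: sumr_ge0. Qed.

Let normH_le v : norm2 (v *m H) <= U * norm2 v.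
Proof.
rewrite -(@ler_pXn2r _ 2) ?nnegrE ?mulr_ge0 ?norm2_ge0 ?(ltW U0) //.
rewrite exprMn -!sumc2 mulr_sumr; apply: ler_sum => i _; rewrite cmulH exprMn.
have /andP[li Ui] := lamlU i; have lam0 : 0 <= lam i by apply: le_trans li; exact: ltW.
by rewrite ler_wpM2r ?sqr_ge0 // ler_pXn2r ?nnegrE // ltW.
Qed.

Let normH_ge v : l * norm2 v <= norm2 (v *m H).
Proof.
rewrite -(@ler_pXn2r _ 2) ?nnegrE ?mulr_ge0 ?norm2_ge0 ?(ltW l0) //.
rewrite exprMn -!sumc2 mulr_sumr; apply: ler_sum => i _; rewrite cmulH exprMn.
have /andP[li Ui] := lamlU i; have lam0 : 0 <= lam i by apply: le_trans li; exact: ltW.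
by rewrite ler_wpM2r ?sqr_ge0 // ler_pXn2r ?nnegrE // ltW.
Qed.

Let xs_ball : eball xs d xs.
Proof. by rewrite /eball /= subrr norm20. Qed.

Lemma grad_linear x : eball xs d x ->
  norm2 (grad f x - (x - xs) *m H) <= E * norm2 (x - xs).
Proof.
move=> xd; have := grad_expand f2 E0 hessE xs_ball (s := x - xs).
by rewrite addrC subrK gxs subr0 Hs; apply.
Qed.

Lemma grad_norm_ge x : eball xs d x -> l / 2 * norm2 (x - xs) <= norm2 (grad f x).
Proof.
move=> xd; have := grad_linear xd.
have : norm2 ((x - xs) *m H) <= norm2 (grad f x) + norm2 (grad f x - (x - xs) *m H).
  rewrite -{1}(subKr (grad f x) ((x - xs) *m H)); exact: norm2B.
have := normH_ge (x - xs).
have : E * norm2 (x - xs) <= l / 2 * norm2 (x - xs) by rewrite ler_wpM2r ?norm2_ge0.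
lra.
Qed.

(** The linear part of the step multiplies coordinate [i] by [1 - b * lam i]; the nonlinear
    remainder is bounded by [grad_linear]. *)
Lemma gradient_step_coord b y i : 0 <= b -> eball xs d y ->
  c i (y - b *: grad f y - xs) <=
    `|1 - b * lam i| * c i (y - xs) + b * E * \sum_j c j (y - xs).
Proof.
move=> b0 yd.
have -> : y - b *: grad f y - xs = (1 *: (y - xs) + (- b) *: ((y - xs) *m H))
    + (- b) *: (grad f y - (y - xs) *m H).
  by apply/rowP => k; rewrite !mxE; ring.
apply: le_trans (cD _ _ _) _; rewrite cH mulNr cZ normrN (ger0_norm b0).
rewrite lerD2l -mulrA ler_wpM2l //.
apply: le_trans (c_le_norm _ _) _; apply: le_trans (grad_linear yd) _.
by rewrite ler_wpM2l.
Qed.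

(** Three tolerances: [zeta] for the relative error in the Rayleigh quotient, [kappa] for low
    coordinates of the error [x - xs], [tau] for low coordinates of the gradient. *)
Variables (zeta tau kappa : R).
Hypothesis E1 : E <= 1.
Hypothesis zeta1 : zeta <= 16^-1.
Hypothesis zeta2 : zeta <= l / 8.
Hypothesis Ez1 : 2 * E <= zeta.
Hypothesis Ez2 : 2 * E <= zeta * l.
Hypothesis Ez3 : E * (1 + 2 * U) <= zeta * l.
Hypothesis tau0 : 0 <= tau.
Hypothesis tau1 : n%:R * tau ^+ 2 * U <= l / 8.
Hypothesis kappaE : (U * kappa + E) * (2 * n%:R) <= tau * l.
Hypothesis kappa0 : 0 <= kappa.

(** The step-sizes see gradients rather than errors. Negligible low coordinates pass from [x - xs]
    to the gradient because the latter is close to [(x - xs) *m H] and its norm is at least [l / 2]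
    times that of the error. *)
Lemma low_coord_grad x i j : eball xs d x ->
  \sum_(j | lam j < lam i) c j (x - xs) <= kappa * \sum_j c j (x - xs) ->
  lam j < lam i -> c j (grad f x) <= tau * norm2 (grad f x).
Proof.
move=> xd low ji; set e := x - xs in low *; set T := \sum_j c j e in low *.
have ej : c j e <= kappa * T.
  by apply: le_trans low; rewrite (bigD1 j) //= lerDl sumr_ge0.
have cg : c j (grad f x) <= lam j * c j e + E * norm2 e.
  rewrite -(subrK (e *m H) (grad f x)) addrC.
  apply: le_trans (cD _ _ _) _; rewrite cmulH lerD2l.
  by apply: le_trans (c_le_norm _ _) _; exact: grad_linear.
have /andP[_ lj] := lamlU j.
have h1 : lam j * c j e <= U * (kappa * T).
  by rewrite ler_pM // (le_trans (ltW l0)) //; case/andP: (lamlU j).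
have h2 : E * norm2 e <= E * T by rewrite ler_wpM2l //; exact: norm_le_sumc.
have h3 : (U * kappa + E) * T <= (U * kappa + E) * (n%:R * norm2 e).
  by rewrite ler_wpM2l ?sumc_le_norm // addr_ge0 // mulr_ge0 // ltW.
have h4 : (U * kappa + E) * (2 * n%:R) * norm2 e <= tau * l * norm2 e.
  by rewrite ler_wpM2r ?norm2_ge0.
have h5 : tau * (l / 2 * norm2 e) <= tau * norm2 (grad f x).
  by rewrite ler_wpM2l //; exact: grad_norm_ge.
lra.
Qed.

(** With [s] the step and [P] the first-order Taylor remainder of [f], [2 * P] approximates
    [dotp s (s *m H)]. The long step-size is [norm2 s ^+ 2 / (2 * P)]; the short one is
    [2 * P / G ^+ 2], with [G] close to [norm2 (s *m H)]. Both are quotients covered by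
    [rayleigh_step]. *)
Lemma kgd_step (K : 'rV[R]_n -> 'rV[R]_n -> R -> R) x a :
  K = kgd_long f \/ K = kgd_short f ->
  eball xs d x -> eball xs d (x - a *: grad f x) -> 0 < a -> grad f x != 0 ->
  let b := K (x - a *: grad f x) x a in
  [/\ (4 * U)^-1 <= b, b <= 3 / l &
      forall i, \sum_(j | lam j < lam i) c j (x - xs) <= kappa * \sum_j c j (x - xs) ->
        b * lam i <= 3 / 2].
Proof.
move=> hK xd; set s := - (a *: grad f x); set y := x + s => yd a0 g0 b.
have ng0 : 0 < norm2 (grad f x) by rewrite lt_def norm2_eq0 g0 norm2_ge0.
have ns : norm2 s = a * norm2 (grad f x) by rewrite norm2N norm2Z gtr0_norm.
have ns0 : 0 < norm2 s by rewrite ns mulr_gt0.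
have cs i : c i s = a * c i (grad f x) by rewrite cN cZ gtr0_norm.
pose P := f y - f x + a * norm2 (grad f x) ^+ 2.
have PE : P = f y - f x - dotp (grad f x) s.
  by rewrite /P /s dotpNr opprK dotpZr sqr_norm2.
have sHs : dotp s (s *m H) = \sum_i lam i * c i s ^+ 2.
  by rewrite cHc dotpC.
have hP : `|2 * P - \sum_i lam i * c i s ^+ 2| <= 2 * E * norm2 s ^+ 2.
  have := value_expand f2 E0 hessE xd yd; rewrite -PE Hs sHs => h.
  have -> : 2 * P - \sum_i lam i * c i s ^+ 2 = 2 * (P - 2^-1 * \sum_i lam i * c i s ^+ 2).
    by field.
  by rewrite normrM ger0_norm // -mulrA ler_wpM2l.
have low i : \sum_(j | lam j < lam i) c j (x - xs) <= kappa * \sum_j c j (x - xs) ->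
    \sum_(j | lam j < lam i) c j s ^+ 2 <= n%:R * tau ^+ 2 * norm2 s ^+ 2.
  move=> hlow; apply: (@le_trans _ _ (\sum_(j | lam j < lam i) (tau * norm2 s) ^+ 2)).
    apply: ler_sum => j ji.
    rewrite ler_pXn2r ?nnegrE ?mulr_ge0 ?norm2_ge0 // cs ns mulrCA ler_wpM2l ?(ltW a0) //.
    exact: low_coord_grad hlow ji.
  rewrite sumr_const exprMn -[leLHS]mulr_natl -[leRHS]mulrA.
  rewrite ler_wpM2r ?mulr_ge0 ?sqr_ge0 ?norm2_ge0 //.
  by rewrite ler_nat (leq_trans (max_card _)) // card_ord.
have s2 : 0 < norm2 s ^+ 2 by rewrite exprn_gt0.
have zs : 2 * E * norm2 s ^+ 2 <= zeta * l * norm2 s ^+ 2 by rewrite ler_wpM2r // ltW.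
case: hK => EK.
  have bE : b = norm2 s ^+ 2 / (2 * P).
    rewrite /b EK /kgd_long ns.
    have -> : 2 + 2 * (f y - f x) / (a * norm2 (grad f x) ^+ 2) =
        2 * P / (a * norm2 (grad f x) ^+ 2).
      by rewrite /P; field; rewrite !gt_eqF.
    by rewrite invf_div exprMn; ring.
  have hN : `|norm2 s ^+ 2 - \sum_i c i s ^+ 2| <= zeta * \sum_i c i s ^+ 2.
    rewrite sumc2 subrr normr0 mulr_ge0 ?(ltW s2) //.
    by apply: le_trans Ez1; rewrite mulr_ge0.
  have hM : `|2 * P - \sum_i lam i * c i s ^+ 2| <= zeta * \sum_i c i s ^+ 2.
    by apply: (le_trans hP); rewrite sumc2 ler_wpM2r // ltW.
  have [||h1 h2 h3] := rayleigh_step l0 lamlU _ _ zeta1 zeta2 hN hM.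
  - by move=> i; exact: sqr_ge0.
  - by rewrite sumc2.
  rewrite bE; split=> // i /low hl; apply: h3; apply: (le_trans hl).
  rewrite sumc2 ler_wpM2r ?(ltW s2) //.
  rewrite -(ler_pM2r U0); apply: (le_trans tau1); have := lU; lra.
have bE : b = (2 * P) / norm2 (grad f y - grad f x) ^+ 2.
  by rewrite /b EK /kgd_short -/s -/y; congr (2 * _ / _); rewrite /P; ring.
set G := norm2 (grad f y - grad f x) in bE.
pose q i := lam i * c i s ^+ 2.
have q0 i : 0 <= q i.
  rewrite /q mulr_ge0 ?sqr_ge0 //.
  by case/andP: (lamlU i) => + _; exact: le_trans (ltW l0).
have qQ : l * norm2 s ^+ 2 <= \sum_i q i.
  rewrite -sumc2 mulr_sumr; apply: ler_sum => i _; rewrite ler_wpM2r ?sqr_ge0 //.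
  by case/andP: (lamlU i).
have Q0 : 0 < \sum_i q i by apply: lt_le_trans qQ; rewrite mulr_gt0.
have z0 : 0 <= zeta by apply: le_trans Ez1; rewrite mulr_ge0.
have zQ : zeta * l * norm2 s ^+ 2 <= zeta * \sum_i q i.
  by rewrite -mulrA ler_wpM2l.
have hN : `|2 * P - \sum_i q i| <= zeta * \sum_i q i.
  by apply: (le_trans hP); apply: (le_trans zs).
have lq : \sum_i lam i * q i = norm2 (s *m H) ^+ 2.
  by rewrite -sumc2; apply: eq_bigr => i _; rewrite cmulH /q; ring.
have hM : `|G ^+ 2 - \sum_i lam i * q i| <= zeta * \sum_i q i.
  rewrite lq; apply: le_trans zQ.
  have hG : norm2 (grad f y - grad f x - s *m H) <= E * norm2 s.
    by have := grad_expand f2 E0 hessE xd yd; rewrite Hs.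
  have sH := normH_le s.
  have G1 : G <= norm2 (s *m H) + E * norm2 s.
    rewrite /G -{1}(subrK (s *m H) (grad f y - grad f x)) addrC.
    by apply: le_trans (norm2D _ _) _; rewrite lerD2l.
  have G2 : norm2 (s *m H) <= G + E * norm2 s.
    rewrite -{1}(subKr (grad f y - grad f x) (s *m H)).
    by apply: le_trans (norm2B _ _) _; rewrite lerD2l.
  have Gge : 0 <= G by exact: norm2_ge0.
  have SHge := norm2_ge0 (s *m H).
  have key : E * (1 + 2 * U) * norm2 s ^+ 2 <= zeta * l * norm2 s ^+ 2.
    by rewrite ler_wpM2r // ltW.
  apply: le_trans key.
  have Es : E * norm2 s <= norm2 s by rewrite ler_piMl // ltW.
  have h : `|G - norm2 (s *m H)| <= E * norm2 s by rewrite ler_norml; apply/andP; split; lra.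
  (* The difference of squares is at most [E * norm2 s] times [(1 + 2 * U) * norm2 s], which is
     where [Ez3] comes from. *)
  rewrite subr_sqr normrM.
  have h' : `|G + norm2 (s *m H)| <= (1 + 2 * U) * norm2 s.
    rewrite ger0_norm ?addr_ge0 //; lra.
  have -> : E * (1 + 2 * U) * norm2 s ^+ 2 = (E * norm2 s) * ((1 + 2 * U) * norm2 s) by ring.
  by rewrite ler_pM.
have [h1 h2 h3] := rayleigh_step l0 lamlU q0 Q0 zeta1 zeta2 hN hM.
rewrite bE; split=> // i /low hl; apply: h3.
(* The short weights carry an extra factor between [l] and [U]: low weights grow by at most [U], and
   the total is at least [l * norm2 s ^+ 2]. *)
apply: (@le_trans _ _ (U * (n%:R * tau ^+ 2 * norm2 s ^+ 2))).
  apply: (@le_trans _ _ (U * \sum_(j | lam j < lam i) c j s ^+ 2)).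
    rewrite mulr_sumr; apply: ler_sum => j _; rewrite /q ler_wpM2r ?sqr_ge0 //.
    by case/andP: (lamlU j).
  by rewrite ler_wpM2l // ltW.
have h4 : n%:R * tau ^+ 2 * U * norm2 s ^+ 2 <= l / 8 * norm2 s ^+ 2.
  by rewrite ler_wpM2r // ltW.
lra.
Qed.

End Step.

(** * Choice of constants and convergence of the iterates *)

Lemma CkW (R : realType) (n k : nat) (f : 'rV[R]_n -> R) : Ck k.+1 f -> Ck k f.
Proof.
elim: k f => [|k IHk] f [cf hf]; split=> // i.
by have [h1 h2] := hf i; split=> //; exact: IHk.
Qed.

Lemma R_linear_cvg (R : realType) (n : nat) (x : nat -> 'rV[R]_n) (xs : 'rV[R]_n) :
  R_linear x xs -> x @ \oo --> xs.
Proof.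
move=> [C [th [C0 /andP[th0 th1] hx]]].
apply/cvgrPdist_le => /= e e0.
have th_lt1 : `|th| < 1 by rewrite gtr0_norm.
have /cvgrPdist_le/(_ (e / C)) := cvg_expr th_lt1.
rewrite divr_gt0 // => /(_ isT); apply: filterS => k.
rewrite sub0r normrN ger0_norm ?exprn_ge0 ?(ltW th0) // ler_pdivlMr // mulrC => h.
rewrite distrC; apply: le_trans (norm2_ge_norm _) _.
exact: le_trans (hx k) h.
Qed.

(** The tolerances are fixed first and the threshold [Em] for [E] last, so that the ball can still
    be shrunk afterwards. *)
Lemma step_constants (R : realFieldType) (n : nat) (l U : R) : 0 < l -> l <= U ->
  exists (zeta tau kappa Em : R),
  [/\ zeta <= 16^-1 /\ zeta <= l / 8,
      0 <= tau /\ n%:R * tau ^+ 2 * U <= l / 8,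
      0 < kappa /\ 0 < Em &
      forall E, E <= Em ->
        [/\ E <= l / 2 /\ E <= 1, 2 * E <= zeta /\ 2 * E <= zeta * l,
            E * (1 + 2 * U) <= zeta * l &
            (U * kappa + E) * (2 * n%:R) <= tau * l]].
Proof.
move=> l0 lU; have U0 : 0 < U by apply: lt_le_trans lU.
(* Adding 1 keeps the denominators nonzero when [n = 0]. *)
pose N : R := n%:R + 1.
have N0 : 0 < N by rewrite ltr_wpDl.
have nN : n%:R <= N by rewrite lerDl.
pose zeta := Num.min (16^-1 : R) (l / 8).
have z0 : 0 < zeta by rewrite lt_min invr_gt0 ltr0n /= divr_gt0.
pose tau := l / (8 * U * N).
have t0 : 0 < tau by rewrite divr_gt0 // !mulr_gt0.
have tE : tau * U * N = l / 8.
  by rewrite /tau; field; rewrite !gt_eqF.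
have t1 : tau <= 1.
  rewrite ler_pdivrMr ?mulr_gt0 // mul1r.
  have : U * 1 <= U * N by rewrite ler_wpM2l ?(ltW U0) // lerDr.
  lra.
(* [kappa] and the last term of [Em] each use half of the budget [tau * l]. *)
pose kappa := tau * l / (4 * N * U).
pose Em := Num.min 1 (Num.min (l / 2) (Num.min (zeta / 2) (Num.min (zeta * l / 2)
  (Num.min (zeta * l / (1 + 2 * U)) (tau * l / (4 * N)))))).
have U21 : 0 < 1 + 2 * U by rewrite addr_gt0 // mulr_gt0.
have tl0 : 0 < tau * l := mulr_gt0 t0 l0.
have zl0 : 0 < zeta * l := mulr_gt0 z0 l0.
have N4 : 0 < 4 * N by rewrite mulr_gt0.
exists zeta, tau, kappa, Em; split.
- by split; rewrite ge_min lexx ?orbT.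
- split; first exact: ltW.
  have h : tau ^+ 2 <= tau by rewrite expr2 ler_piMl // ltW.
  have h1 : n%:R * tau ^+ 2 * U <= n%:R * tau * U.
    by rewrite ler_wpM2r ?(ltW U0) // ler_wpM2l.
  have h2 : n%:R * (tau * U) <= N * (tau * U) by rewrite ler_wpM2r // mulr_ge0 // ltW.
  lra.
- split; first exact: divr_gt0 tl0 (mulr_gt0 N4 U0).
  by rewrite /Em !lt_min ltr01 /= !divr_gt0.
move=> E hEm.
have /and5P[E1 E2 E3 E4 /andP[E5 E6]] : [&& E <= 1, E <= l / 2, E <= zeta / 2,
    E <= zeta * l / 2 & (E <= zeta * l / (1 + 2 * U)) && (E <= tau * l / (4 * N))].
  by move: hEm; rewrite !le_min.
split.
- by [].
- by split; rewrite mulrC -ler_pdivlMr.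
- by rewrite -ler_pdivlMr.
rewrite ler_pdivlMr ?mulr_gt0 // in E6.
have h : U * kappa * (4 * N) = tau * l by rewrite /kappa; field; rewrite !gt_eqF.
have k0 : 0 <= U * kappa.
  exact: ltW (mulr_gt0 U0 (divr_gt0 tl0 (mulr_gt0 N4 U0))).
have hE : E * (2 * n%:R) <= tau * l / 2.
  (* The claim ranges over every [E <= Em], negative values included. *)
  have [E0|E0] := leP 0 E.
    by have := ler_wpM2l E0 nN; lra.
  apply: (@le_trans _ _ 0); first by rewrite mulr_le0_ge0 ?(ltW E0) // mulr_ge0.
  by rewrite divr_ge0 // mulr_ge0 ?(ltW t0) ?(ltW l0).
have := ler_wpM2l k0 nN; lra.
Qed.

Theorem theorem4p2 (R : realType) (n : nat) (f : 'rV[R]_n -> R)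
    (xs xbar : 'rV[R]_n) (rho Lam1 Lam2 L : R)
    (K : 'rV[R]_n -> 'rV[R]_n -> R -> R) :
  Ck 3 f ->
  (forall x, f xs <= f x) ->
  0 < rho -> 0 < Lam1 -> 0 < Lam2 -> 0 < L ->
  compact (sublevel f xbar) ->
  eball xs rho `<=` sublevel f xbar ->
  (forall x v : 'rV[R]_n, sublevel f xbar x ->
     qform (hess f x) v <= Lam1 * norm2 v ^+ 2) ->
  (forall x y : 'rV[R]_n, sublevel f xbar x -> sublevel f xbar y ->
     opnorm2 (hess f x - hess f y) <= L * norm2 (x - y)) ->
  (forall x v : 'rV[R]_n, eball xs rho x ->
     Lam2 * norm2 v ^+ 2 <= qform (hess f x) v) ->
  (K = kgd_long f \/ K = kgd_short f) ->
  exists r : R, 0 < r < rho /\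
    forall (delta : R), 0 < delta < r ->
    forall (x : nat -> 'rV[R]_n) (a : nat -> R),
      eball xs delta (x 0%N) -> eball xs delta (x 1%N) ->
      kgd_iterates f K x a ->
      (x @ \oo --> xs) /\ R_linear x xs.
Proof.
move=> f3 fmin rho0 Lam10 l0 L0 _ ballsub hLam1 hL hLam2 hK.
have f2 := CkW f3; have gxs := grad_min f2 fmin.
have xsb e : 0 < e -> eball xs e xs by move=> e0; rewrite /eball /= subrr norm20.
pose H := hess f xs.
have hessL e y v : 0 < e <= rho -> eball xs e y ->
    norm2 (v *m (hess f y)^T - v *m H^T) <= L * e * norm2 v.
  move=> /andP[e0 er] ye.
  have -> : v *m (hess f y)^T - v *m H^T = v *m (hess f y - H)^T.
    by rewrite [in RHS]raddfB mulmxBr.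
  apply: le_trans (opnorm2P _ _) _; rewrite ler_wpM2r ?norm2_ge0 //.
  apply: le_trans (hL _ _ _ _) _.
  - by apply: ballsub; exact: lt_le_trans ye er.
  - by apply: ballsub; exact: xsb.
  - by rewrite ler_wpM2l ?(ltW L0) // ltW.
have Hs : H^T = H := hess_sym f2 rho0 (ltW L0) hessL.
have [lam [c spec]] := spectral_coords_exist Hs.
(* The maximum gives [l <= U] without an eigenvector, hence also for [n = 0]. *)
pose l := Lam2; pose U := Num.max Lam1 Lam2.
have lU : l <= U by rewrite le_max lexx orbT.
have U0 : 0 < U by apply: lt_le_trans lU.
have lamlU i : l <= lam i <= U.
  have [v v0 vH] := coord_eigen spec i.
  have nv0 : 0 < norm2 v ^+ 2.
    by rewrite exprn_gt0 // lt_def norm2_eq0 v0 norm2_ge0.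
  have qv : qform H v = lam i * norm2 v ^+ 2.
    by rewrite /qform vH -scalemxAl mxE sqr_norm2.
  have := hLam1 xs v (ballsub _ (xsb _ rho0)); have := hLam2 xs v (xsb _ rho0).
  rewrite -/H qv !ler_pM2r // => -> h /=.
  by rewrite le_max h.
have [zeta [tau [kappa [Em [[z1 z2] [t0 t1] [k0 Em0] hE]]]]] := step_constants n l0 lU.
(* [B] bounds [1 - b * lam i] in modulus for every admissible step [b], and [cc] does so once
   [b * lam i <= 3 / 2]; [theta] is the midpoint of [cc] and 1. *)
pose B := 1 + 3 * U / l; pose cc := 1 - l / (4 * U); pose theta := (cc + 1) / 2.
have lU4 : 0 < l / (4 * U) <= 4^-1.
  rewrite divr_gt0 ?mulr_gt0 //= ler_pdivrMr ?mulr_gt0 // mulrA mulVf // mul1r.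
  by [].
have /andP[lU40 lU41] := lU4.
have cc0 : 0 <= cc by rewrite /cc; lra.
have cth : cc < theta by rewrite /theta /cc; lra.
have th1 : theta < 1 by rewrite /theta /cc; lra.
have th0 : 0 < theta by apply: le_lt_trans cth.
have B0 : 0 <= B by rewrite addr_ge0 // divr_ge0 ?mulr_ge0 ?(ltW U0) // ltW.
have [M M1 decay] := spectral_decay lam B0 cc0 cth th1 k0.
have M0 : 0 < M by apply: lt_le_trans M1.
(* [M] is fixed before [E], so [E] can be taken small enough that the perturbation [b * E], with
   [b <= 3 / l], stays below [M^-1]. *)
pose E := Num.min Em (l / (3 * M)).
have E0 : 0 < E by rewrite lt_min Em0 divr_gt0 // mulr_gt0.
have EM : 3 / l * E <= M^-1.
  apply: (@le_trans _ _ (3 / l * (l / (3 * M)))).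
    by rewrite ler_wpM2l ?divr_ge0 ?(ltW l0) // /E ge_min lexx orbT.
  by rewrite le_eqVlt; apply/orP; left; apply/eqP; field; rewrite !gt_eqF.
have [|[El2 E1] [Ez1 Ez2] Ez3 kE] := hE E; first by rewrite /E ge_min lexx.
pose d := Num.min rho (E / L).
have d0 : 0 < d by rewrite lt_min rho0 divr_gt0.
have hessE y v : eball xs d y ->
    norm2 (v *m (hess f y)^T - v *m H^T) <= E * norm2 v.
  move=> yd; have dr : 0 < d <= rho by rewrite d0 /d ge_min lexx.
  apply: (le_trans (hessL _ _ v dr yd)); rewrite ler_wpM2r ?norm2_ge0 //.
  by rewrite mulrC -ler_pdivlMr // /d ge_min lexx orbT.
have gN0 y : eball xs d y -> grad f y = 0 -> y = xs.
  move=> yd gy; have := grad_norm_ge f2 gxs hessE Hs spec l0 lamlU d0 (ltW E0) El2 yd.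
  rewrite gy norm20 pmulr_rle0 ?divr_gt0 // => h.
  by apply/eqP; rewrite -subr_eq0 -norm2_eq0 eq_le h norm2_ge0.
pose N : R := n%:R + 1.
have N0 : 0 < N by rewrite ltr_wpDl.
have MN0 : 0 < 2 * M * N by rewrite !mulr_gt0.
(* The initial coordinate sums total at most [2 * n * r]; multiplied by [M] this stays below [d]. *)
pose r := d / (2 * M * N).
have r0 : 0 < r by exact: divr_gt0.
have rd : r * (2 * M * N) = d by rewrite /r divfK // gt_eqF.
have MN1 : 1 <= M * N by rewrite mulr_ege1 // lerDr.
have rltd : r < d.
  rewrite -rd ltr_pMr //; lra.
exists r; split.
  by rewrite r0 (lt_le_trans rltd) // /d ge_min lexx.
move=> delta /andP[del0 delr] x a x0 x1 [a0 hx].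
pose u k i := c i (x k - xs).
have u0 k i : 0 <= u k i by exact: coord_ge0 spec _ _.
pose S := \sum_i u 0%N i + \sum_i u 1%N i.
have S0 : 0 <= S by rewrite addr_ge0 // sumr_ge0.
have sumc_le v : \sum_i c i v <= n%:R * norm2 v.
  exact: sum_coord_le spec _.
have Sd : M * S < d.
  have h1 : S <= n%:R * (2 * r).
    apply: (@le_trans _ _ (n%:R * norm2 (x 0%N - xs) + n%:R * norm2 (x 1%N - xs))).
      by apply: lerD; exact: sumc_le.
    rewrite -mulrDr ler_wpM2l //.
    by move: x0 x1; rewrite /eball /= => x0 x1; lra.
  have h2 : M * S <= M * (n%:R * (2 * r)) by rewrite ler_wpM2l // ltW.
  have h3 : 0 < M * (2 * r) by apply: mulr_gt0 => //; apply: mulr_gt0.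
  by rewrite -rd /N; lra.
have step k : eball xs d (x k) -> eball xs d (x k.+1) ->
    (grad f (x k) != 0 -> 0 < a k) -> grad f (x k) != 0 ->
    [/\ (4 * U)^-1 <= a k.+1, a k.+1 <= 3 / l &
      forall i, \sum_(j | lam j < lam i) u k j <= kappa * \sum_j u k j ->
        a k.+1 * lam i <= 3 / 2].
  move=> xk xk1 ak gk; have [xE aE] := hx k; rewrite (aE gk) xE.
  apply: (kgd_step f2 gxs hessE Hs spec l0 lU lamlU d0 (ltW E0) El2 E1 z1 z2 Ez1 Ez2 Ez3
    t0 t1 kE (ltW k0) hK xk _ (ak gk) gk).
  by rewrite -xE.
have stay k : grad f (x k) = 0 -> x k.+1 = x k.
  by move=> gk; have [-> _] := hx k; rewrite gk scaler0 subr0.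
(* The rule constrains [a k.+1] only if the gradient at [x k] is nonzero; this follows from its
   being nonzero at [x k.+1], as the iteration is otherwise stationary. *)
have apos m : (forall k, (k <= m)%N -> eball xs d (x k)) ->
    forall k, (k <= m)%N -> grad f (x k) != 0 -> 0 < a k.
  move=> hm; elim=> [//|k IHk] km g1.
  have gk : grad f (x k) != 0.
    by apply: contra_neq g1 => gk; rewrite (stay _ gk).
  have [h _ _] := step k (hm _ (ltnW km)) (hm _ km) (IHk (ltnW km)) gk.
  by apply: lt_le_trans h; rewrite invr_gt0 mulr_gt0.
have le_B i b : 0 <= b <= 3 / l -> `|1 - b * lam i| <= B.
  move=> /andP[b0 bl]; have /andP[li Ui] := lamlU i.
  have h : b * lam i <= 3 / l * U.
    by rewrite ler_pM //; apply: le_trans li; exact: ltW.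
  apply: le_trans (ler_normB _ _) _; rewrite normr1 lerD2l ger0_norm ?mulr_ge0 //.
    by rewrite mulrAC.
  by apply: le_trans li; exact: ltW.
have le_cc i b : (4 * U)^-1 <= b -> b * lam i <= 3 / 2 -> `|1 - b * lam i| <= cc.
  move=> b0 bl; have /andP[li Ui] := lamlU i.
  have h : l / (4 * U) <= b * lam i.
    by rewrite mulrC ler_pM // ?(ltW l0) // invr_ge0 mulr_ge0 // ltW.
  by rewrite ler_norml; apply/andP; split; rewrite /cc; lra.
have recur m : (forall k, (k <= m.+1)%N -> eball xs d (x k)) ->
    forall k, (k.+1 < m.+2)%N -> forall i,
       u k.+2 i <= B * u k.+1 i + M^-1 * \sum_j u k.+1 j /\
       (\sum_(j | lam j < lam i) u k j <= kappa * \sum_j u k j ->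
        u k.+2 i <= cc * u k.+1 i + M^-1 * \sum_j u k.+1 j).
  move=> hm k km i.
  have kmW : (k <= m.+1)%N := ltnW (km : (k < m.+1)%N).
  have xk := hm _ kmW; have xk1 := hm k.+1 km.
  have sum0 : 0 <= M^-1 * \sum_j u k.+1 j.
    by rewrite mulr_ge0 ?invr_ge0 ?(ltW M0) // sumr_ge0.
  (* A vanishing gradient inside the ball means [x k = xs], and all later coordinates are zero. *)
  have [gk|gk] := eqVneq (grad f (x k)) 0.
    have xkE := gN0 _ xk gk; have xk1E : x k.+1 = xs by rewrite (stay _ gk).
    have xk2E : x k.+2 = xs by rewrite stay ?xk1E.
    have -> : u k.+2 i = 0.
      by rewrite /u xk2E (coord_zero spec).
    by split=> [|_]; rewrite addr_ge0 // mulr_ge0.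
  have [h1 h2 h3] := step k xk xk1 (apos _ hm _ kmW) gk.
  have b0 : 0 <= a k.+1 by apply: le_trans h1; rewrite invr_ge0 mulr_ge0 // ltW.
  have uk2 : u k.+2 i <= `|1 - a k.+1 * lam i| * u k.+1 i + M^-1 * \sum_j u k.+1 j.
    rewrite {1}/u; have [-> _] := hx k.+1.
    apply: le_trans (gradient_step_coord f2 gxs hessE Hs spec d0 (ltW E0) i b0 xk1) _.
    rewrite lerD2l ler_wpM2r ?sumr_ge0 // => [j _|]; first exact: u0.
    by apply: le_trans EM; rewrite ler_wpM2r // ltW.
  split=> [|/h3 h]; apply: (le_trans uk2); rewrite lerD2r ler_wpM2r //.
    by apply: le_B; rewrite b0.
  exact: le_cc.
have sum_norm k : norm2 (x k - xs) <= \sum_i u k i by exact: norm_le_sum_coord spec _.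
(* The recursion for index [m.+2] needs only earlier iterates in the ball, and the decay estimate
   then places [x m.+2] there too. *)
have inball m k : (k <= m.+1)%N -> eball xs d (x k).
  elim: m k => [|m IHm] k.
    by case: k => [|[|//]] _; apply: lt_trans rltd; exact: lt_trans delr.
  rewrite leq_eqVlt => /orP[/eqP ->|]; last exact: IHm.
  rewrite /eball /=; apply: le_lt_trans (sum_norm _) _.
  apply: le_lt_trans (decay u m.+2 u0 (recur m IHm) m.+2 (leqnn _)) _.
  apply: le_lt_trans Sd; rewrite -/S ler_piMr ?mulr_ge0 ?(ltW M0) //.
  by rewrite exprn_ile1 // ltW.
have xlin : R_linear x xs.
  (* The added 1 keeps the constant positive when [S = 0]. *)
  exists (M * S + 1), theta; split.
  - by rewrite ltr_wpDl // mulr_ge0 // ltW.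
  - by rewrite th0.
  move=> k; apply: le_trans (sum_norm _) _.
  apply: le_trans (decay u k.+2 u0 (recur k (fun j => inball k j)) k (leqW (leqW (leqnn _)))) _.
  by rewrite -/S ler_wpM2r ?exprn_ge0 ?(ltW th0) // lerDl.
by split=> //; exact: R_linear_cvg.
Qed.
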